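(* Let $F^\bullet$ be a bounded sequence of based finite-rank free $R_n$-modules with homogeneous basis indexed by $I$, let $(x_i)_{i\in I}\in(\mathbb{R}^n)^I$ be a choice of points, and let $X(F^\bullet)=\{X(F^\bullet)_k\}_{k\in\mathbb{N}}$ be the associated collection of simplices over $T^n$. Then $X(F^\bullet)$ is a linear semi-simplicial complex over $T^n$. If the $x_i$ are generic and $F^{-k}\cong 0$ for all $k\geq n$, then $X(F^\bullet)$ is immersed.
   Context: $R_n:=\mathbb{C}[z_1^{\pm1},\dots,z_n^{\pm1}]$, $T^n=\mathbb{R}^n/\mathbb{Z}^n$, $\pi:\mathbb{R}^n\to T^n$ is the projection, and $z^m=z_1^{m_1}\cdots z_n^{m_n}$ for $m\in\mathbb{Z}^n$. Sequences. $F^\bullet=\cdots\to F^k\xrightarrow{d^k}F^{k+1}\to\cdots$ is a bounded sequence of finite-rank free $R_n$-modules and homomorphisms (it is not required that $d^2=0$). It is based: for each $k$ there is a fixed finite set $I_k$ and an isomorphism $F^k\cong R_n^{\oplus I_k}$. $I:=\bigsqcup_k I_k$ and $\deg:I\to\mathbb{Z}$ is $\deg(i)=k$ for $i\in I_k$. It is assumed $F^0\not\cong0$ and $F^k\cong0$ for $k>0$. For $i\in I_{k+1}$, $j\in I_k$, $d^k_{ij}\in R_n$ is the entry in row $i$, column $j$ of the matrix of $d^k$. Exponent sets $E_{ij}\subset\mathbb{Z}^n$ for $i,j\in I$: (a) if $\deg(i)\le\deg(j)$, $E_{ij}=\emptyset$; (b) if $\deg(i)=\deg(j)+1$, $E_{ij}$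 is the set of exponents of $d^{\deg(j)}_{ij}$, i.e. $d^{\deg(j)}_{ij}=\sum_{m\in E_{ij}}c_{ijm}z^m$ with all $c_{ijm}\ne0$; (c) if $\deg(i)=\deg(j)+k$ with $k>1$, then $m\in E_{ij}$ iff $m=\sum_{\ell=1}^k m_\ell$ for some $i_1,\dots,i_{k-1}\in I$ with $\deg(i_\ell)=\deg(j)+\ell$ and some $(m_1,\dots,m_k)\in E_{i_1j}\times E_{i_2i_1}\times\cdots\times E_{i\,i_{k-1}}$. Simplices over $T^n$. A semi-simplicial complex over $T^n$ is a collection $X=\{X_k\}_{k\in\mathbb{N}}$ where each $X_k$ is a set of maps $\sigma:\Delta^k\to T^n$ whose restriction to each $m$-dimensional face belongs to $X_m$. It is immersed if for all $k$ and $\sigma\in X_k$ the restriction of $\sigma$ to the interior of $\Delta^k$ is an embedding. It is linear if each $\sigma$ is the restriction of $\pi$ to the convex hull of an ordered tuple of points of $\mathbb{R}^n$. For $y_0,\dots,y_k\in\mathbb{R}^n$, $[y_0,\dots,y_k]$ is the convex hull and $[y_0,\dots,y_k]\bmod\mathbb{Z}^n$ is the associated $k$-simplex $\Delta^k\to T^n$ (linear map sending vertices in order to $y_0,\dots,y_k$, followed by $\pi$). $X(F^\bullet)$. Given points $x_i\in\mathbb{R}^n$ $(i\in I)$, $$X(F^\bullet)_k:=\bigcup_{i_0,\dots,i_k\in I}\Big\{\big[x_{i_0},\,x_{i_1}+m_1,\,\dots,\,x_{i_k}+\textstyle\sum_{\ell=1}^k m_\ell\big]\bmod\mathbb{Z}^n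 \;:\;(m_1,\dots,m_k)\in E_{i_1i_0}\times\cdots\times E_{i_ki_{k-1}}\Big\},$$ with $X(F^\bullet)_0=\{[x_i]\bmod\mathbb{Z}^n\}_{i\in I}$. Generic: a conclusion holds for generic $x_i$ if the set of $(x_i)_{i\in I}\in(\mathbb{R}^n)^I$ for which it fails has measure zero. *)

(* Defs.v *)
From HB Require Import structures.
From mathcomp Require Import all_boot all_order all_algebra.
From mathcomp Require Import finmap generic_quotient monalg complex.
From mathcomp Require Import all_classical all_reals all_analysis.

Set Implicit Arguments.
Unset Strict Implicit.
Unset Printing Implicit Defensive.

Import Order.TTheory GRing.Theory Num.Theory.
Import numFieldNormedType.Exports.

Local Open Scope classical_set_scope.
Local Open Scope ring_scope.

(* [laurent K n] is K[z_1^{+-1}, ..., z_n^{+-1}]: finitely supported functions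
Z^n -> K under convolution, [<< c *g m >>] being c z^m, [f@_m] the coefficient
of z^m in f, and [msupp f] the set of exponents of f.  The ring structure that
[monalg] puts on [{malg K[M]}] is only available for monoids M without
nontrivial units, so it is rebuilt here for the group Z^n. *)

Definition laurent (K : comNzRingType) (n : nat) : Type := {malg K['rV[int]_n]}.

Section LaurentRing.
Variables (K : comNzRingType) (n : nat).
Local Notation L := (laurent K n).
Local Notation Z := 'rV[int]_n.
Implicit Types (f g h : L) (a b m : Z).

HB.instance Definition _ := GRing.Zmodule.on L.

Definition laurent_one : L := << 1 *g (0 : Z) >>.

Definition laurent_mul f g : L :=
  \sum_(a <- msupp f) \sum_(b <- msupp g) << f@_a * g@_b *g a + b >>.

Let mulw (d1 d2 : {fset Z}) f g :
  (msupp f `<=` d1)%fset -> (msupp g `<=` d2)%fset ->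
  laurent_mul f g = \sum_(a <- d1) \sum_(b <- d2) << f@_a * g@_b *g a + b >>.
Proof.
move=> le1 le2; rewrite /laurent_mul (big_fset_incl _ le1) /=.
  apply/eq_bigr=> a _; apply/big_fset_incl => // b _ /mcoeff_outdom ->.
  by rewrite mulr0 monalgU0.
move=> a _ /mcoeff_outdom fa.
by rewrite big1 => // b _; rewrite fa mul0r monalgU0.
Qed.

Let mulC : commutative laurent_mul.
Proof.
move=> f g; rewrite /laurent_mul exchange_big /=.
by apply/eq_bigr => b _; apply/eq_bigr => a _; rewrite mulrC addrC.
Qed.

Let mulUg c a g :
  laurent_mul << c *g a >> g = \sum_(b <- msupp g) << c * g@_b *g a + b >>.
Proof.
rewrite (mulw msuppU_le (fsubset_refl _)) big_seq_fset1.
by apply/eq_bigr => b _; rewrite mcoeffUU.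
Qed.

Let mulUU c1 c2 a b :
  laurent_mul << c1 *g a >> << c2 *g b >> = << c1 * c2 *g a + b >>.
Proof. by rewrite (mulw msuppU_le msuppU_le) !big_seq_fset1 !mcoeffUU. Qed.

Let mul0 : left_zero 0 laurent_mul.
Proof. by move=> g; rewrite /laurent_mul msupp0 big_seq_fset0. Qed.

Let mul1 : left_id laurent_one laurent_mul.
Proof.
move=> g; rewrite mulUg [RHS]monalgE.
by apply/eq_bigr=> b _; rewrite mul1r add0r.
Qed.

Let mulDl : left_distributive laurent_mul +%R.
Proof.
move=> f g h.
rewrite [in RHS](mulw (fsubsetUl _ (msupp g)) (fsubset_refl _)).
rewrite [in RHS](mulw (fsubsetUr (msupp f) _) (fsubset_refl _)).
rewrite (mulw (msuppD_le _ _) (fsubset_refl _)).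
rewrite -big_split /=; apply/eq_bigr=> a _.
rewrite -big_split /=; apply/eq_bigr=> b _.
by rewrite mcoeffD mulrDl monalgUD.
Qed.

Let mulDr : right_distributive laurent_mul +%R.
Proof. by move=> f g h; rewrite mulC mulDl !(mulC _ f). Qed.

Let mulr0 : right_zero 0 laurent_mul.
Proof. by move=> g; rewrite mulC mul0. Qed.

Let mulE1 f g : laurent_mul f g = \sum_(a <- msupp f) laurent_mul << f@_a *g a >> g.
Proof. by apply/eq_bigr=> a _; rewrite mulUg. Qed.

Let mulE2 f g : laurent_mul f g = \sum_(b <- msupp g) laurent_mul f << g@_b *g b >>.
Proof. by rewrite mulC mulE1; apply: eq_bigr => b _; rewrite mulC. Qed.

Let mulA : associative laurent_mul.
Proof.
move=> f g h.
rewrite [in RHS](mulE1 f g).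
rewrite [RHS](big_morph (laurent_mul^~ _) (fun _ _ => mulDl _ _ _) (mul0 _)).
rewrite mulE1; apply/eq_bigr=> a _.
rewrite [in RHS](mulE2 _ g) [in LHS](mulE1 g h).
rewrite [LHS](big_morph (laurent_mul _) (fun _ _ => mulDr _ _ _) (mulr0 _)).
rewrite [RHS](big_morph (laurent_mul^~ _) (fun _ _ => mulDl _ _ _) (mul0 _)).
apply/eq_bigr=> b _.
rewrite [in LHS](mulE2 _ h) [in RHS](mulE2 _ h).
rewrite [LHS](big_morph (laurent_mul _) (fun _ _ => mulDr _ _ _) (mulr0 _)).
by apply/eq_bigr=> c _; rewrite !mulUU mulrA addrA.
Qed.

Let one_neq0 : laurent_one != 0.
Proof.
apply/eqP => /(congr1 (mcoeff (0 : Z))) /eqP.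
by rewrite mcoeffUU mcoeff0 oner_eq0.
Qed.

HB.instance Definition _ := GRing.Zmodule_isComNzRing.Build L
  mulA mulC mul1 mulDl one_neq0.

Lemma laurent_mulUU c1 c2 a b :
  (<< c1 *g a >> : L) * << c2 *g b >> = << c1 * c2 *g a + b >>.
Proof. exact: mulUU. Qed.

End LaurentRing.

Section Torus.
Variables (R : realType) (n : nat).

Definition int_translate (x y : 'rV[R]_n) : bool :=
  [forall j, x 0 j - y 0 j \is a Num.int].

Let int_translate_refl : reflexive int_translate.
Proof. by move=> x; apply/forallP => j; rewrite subrr rpred0. Qed.

Let int_translate_sym : symmetric int_translate.
Proof.
by move=> x y; apply: eq_forallb => j; rewrite -[LHS]rpredN opprB.
Qed.

Let int_translate_trans : transitive int_translate.
Proof.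
move=> y x z /forallP xy /forallP yz; apply/forallP => j.
by rewrite -(subrKA (y 0 j)) rpredD.
Qed.

Canonical int_translate_equiv :=
  EquivRel int_translate
    int_translate_refl int_translate_sym int_translate_trans.

Definition torus : Type :=
  quotient_topology {eq_quot int_translate_equiv}%qT.

HB.instance Definition _ := Topological.on torus.

Definition torus_proj (x : 'rV[R]_n) : torus :=
  (\pi_(quotient_topology {eq_quot int_translate_equiv}) x)%qT.

End Torus.

Section Simplices.
Variable R : realType.

Definition std_simplex (k : nat) : set 'rV[R]_k.+1 :=
  [set t | (forall i, 0 <= t 0 i) /\ \sum_i t 0 i = 1].

Definition simplex (k : nat) : topologicalType := set_type (@std_simplex k).

Definition simplex_coord (k : nat) (t : simplex k) : 'rV[R]_k.+1 :=
  @set_val _ (@std_simplex k) t.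

(* The relative interior (the open simplex): neither the interior in R^(k+1),
   which is empty, nor the interior of the space [simplex k] in itself. *)
Definition simplex_interior (k : nat) : set (simplex k) :=
  [set t | forall i, 0 < simplex_coord t 0 i].

Definition face_coord (m k : nat) (phi : 'I_m.+1 -> 'I_k.+1)
    (t : 'rV[R]_m.+1) : 'rV[R]_k.+1 :=
  \row_j \sum_(i | phi i == j) t 0 i.

Lemma face_coord_subproof m k (phi : 'I_m.+1 -> 'I_k.+1) (t : simplex m) :
  face_coord phi (simplex_coord t) \in @std_simplex k.
Proof.
have [t0 t1] : std_simplex (simplex_coord t) := set_valP t.
apply/mem_set; split=> [j|].
  by rewrite mxE sumr_ge0.
rewrite -[RHS]t1 (partition_big phi predT) //=.
by apply: eq_bigr => j _; rewrite mxE.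
Qed.

(* The affine map of standard simplices sending vertex i to vertex phi i; for
   phi strictly increasing it is the inclusion of an m-dimensional face. *)
Definition face_map (m k : nat) (phi : 'I_m.+1 -> 'I_k.+1)
    (t : simplex m) : simplex k :=
  SigSub (face_coord_subproof phi t).

Variable n : nat.

Definition simplex_family := forall k : nat, set (simplex k -> torus R n).

Definition semi_simplicial_complex (X : simplex_family) : Prop :=
  (forall k sigma, X k sigma -> continuous sigma) /\
  (forall k sigma, X k sigma ->
     forall m (phi : 'I_m.+1 -> 'I_k.+1), {homo phi : a b / (a < b)%N} ->
       X m (sigma \o face_map phi)).

(* [y_0, ..., y_k] mod Z^n *)
Definition affine_simplex (k : nat) (y : 'I_k.+1 -> 'rV[R]_n) :
    simplex k -> torus R n :=
  fun t => torus_proj (\sum_i simplex_coord t 0 i *: y i).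

Definition linear_family (X : simplex_family) : Prop :=
  forall k sigma, X k sigma -> exists y, sigma = @affine_simplex k y.

Definition embedding_on (S T : topologicalType) (A : set S) (f : S -> T) :
    Prop :=
  [/\ {within A, continuous f}, set_inj A f
    & forall U : set S, open U ->
        exists2 V : set T, open V & f @` (A `&` U) = f @` A `&` V].

Definition immersed (X : simplex_family) : Prop :=
  forall k sigma, X k sigma -> embedding_on (@simplex_interior k) sigma.

End Simplices.

Notation free_module A J := {ffun J -> A^o}.

(* The set I indexing the homogeneous basis is given together with its degree
   map, and I_k is the fibre over k; since I is finite this makes the sequence
   bounded, see [based_sequence_bounded]. *)
Record based_sequence (R : realType) (n : nat) := BasedSequence {
  bs_index : finType;
  bs_deg : bs_index -> int;
  bs_mod :> int -> lmodType (laurent R[i] n);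
  bs_coord : forall k : int,
    {linear bs_mod k ->
      free_module (laurent R[i] n) {i : bs_index | bs_deg i == k}};
  bs_vect : forall k : int,
    free_module (laurent R[i] n) {i : bs_index | bs_deg i == k} -> bs_mod k;
  bs_coordK : forall k, cancel (bs_coord k) (@bs_vect k);
  bs_vectK : forall k, cancel (@bs_vect k) (bs_coord k);
  bs_diff : forall k : int, {linear bs_mod k -> bs_mod (k + 1)};
  bs_mod0 : exists v : bs_mod 0, v != 0;
  bs_mod_gt0 : forall k : int, 0 < k -> forall v : bs_mod k, v = 0 }.

Lemma based_sequence_bounded (R : realType) n (F : based_sequence R n) :
  exists N : nat, forall k : int, (N < `|k|)%N -> forall v : F k, v = 0.
Proof.
exists (\max_(i : bs_index F) `|bs_deg i|)%N => k Nk v.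
rewrite -[v]bs_coordK -[RHS]bs_coordK linear0; congr bs_vect.
apply/ffunP => -[i ik]; exfalso; move: Nk; apply/negP.
by rewrite -leqNgt -(eqP ik) (leq_bigmax i).
Qed.

Section Exponents.
Variables (R : realType) (n : nat) (F : based_sequence R n).
Local Notation I := (bs_index F).
Local Notation deg := (@bs_deg _ _ F).

Definition bs_entry (k : int) (i : {i : I | deg i == k + 1})
    (j : {j : I | deg j == k}) : laurent R[i] n :=
  bs_coord F (k + 1) (bs_diff F k (bs_vect [ffun j' => (j' == j)%:R])) i.

(* E_ij for deg i = deg j + 1; empty otherwise *)
Definition exponents1 (i j : I) : set 'rV[int]_n :=
  [set m | exists hi : deg i == deg j + 1,
     m \in msupp (bs_entry (exist _ i hi) (exist _ j (eqxx (deg j))))].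

(* E_ij for deg i = deg j + k with k > 1; p is the path j = i_0, i_1, ..., i_k = i *)
Definition exponents_path (i j : I) : set 'rV[int]_n :=
  [set m | exists k : nat, [/\ (1 < k)%N, deg i = deg j + k%:Z &
     exists (p : 'I_k.+1 -> I) (ms : 'I_k -> 'rV[int]_n),
       [/\ p ord0 = j, p ord_max = i,
           forall l : 'I_k.+1, deg (p l) = deg j + (l : nat)%:Z,
           forall l : 'I_k,
             exponents1 (p (lift ord0 l)) (p (widen_ord (leqnSn k) l)) (ms l)
         & m = \sum_l ms l]]].

(* The two members of the union concern disjoint degree differences, and both
   are empty when deg i <= deg j. *)
Definition exponents (i j : I) : set 'rV[int]_n :=
  exponents1 i j `|` exponents_path i j.

Definition complex_of (x : I -> 'rV[R]_n) : simplex_family R n :=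
  fun k => [set sigma |
    exists (i : 'I_k.+1 -> I) (m : 'I_k -> 'rV[int]_n),
      (forall l : 'I_k,
         exponents (i (lift ord0 l)) (i (widen_ord (leqnSn k) l)) (m l)) /\
      sigma = affine_simplex (fun l : 'I_k.+1 =>
        x (i l) + map_mx intr (\sum_(l' < k | (l' < l)%N) m l'))].

End Exponents.

(* Lebesgue-null sets of (R^n)^I, through countable coverings by boxes, as the
   library only has Lebesgue measure on the line. *)
Definition measure_zero (R : realType) (n : nat) (I : finType)
    (A : set (I -> 'rV[R]_n)) : Prop :=
  forall e : R, 0 < e -> exists a b : nat -> I -> 'rV[R]_n,
    [/\ forall k i j, a k i 0 j <= b k i 0 j,
        A `<=` \bigcup_k [set x | forall i j,
                            a k i 0 j <= x i 0 j <= b k i 0 j]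
      & (\sum_(0 <= k <oo)
          (\prod_i \prod_j (b k i 0 j - a k i 0 j))%:E <= e%:E)%E].

(* Main.v *)
Require Import Defs.
From mathcomp Require Import all_boot all_order all_algebra.
From mathcomp Require Import all_classical all_reals all_analysis.
From mathcomp Require Import ring lra zify.
Import Order.TTheory GRing.Theory Num.Theory.
Import numFieldNormedType.Exports.
Local Open Scope classical_set_scope.
Local Open Scope ring_scope.
Set Implicit Arguments.
Unset Strict Implicit.
Unset Printing Implicit Defensive.

(* The faces of a simplex of X(F) belong to X(F) because the exponent sets are
closed under composition: m in E_ij and m' in E_jh give m + m' in E_ih.

Along a simplex the degrees increase strictly and lie in ]-n, 0], so its k + 1
vertices carry distinct indices and k < n.  A linear simplex [y_0, ..., y_k]
that is injective on the closed simplex is an embedding by compactness.  If it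
is not injective, then sum_l s_l y_l is an integer vector N for some s <> 0 of
total sum 0; solving for a vertex y_p with s_p <> 0 expresses x_{i_p}
polynomially in the other points and k real parameters.  As k < n, the points x
with such a relation are the image of a space of dimension < n |I| under a
locally Lipschitz map, a null set, and there are countably many relations. *)

(** * The torus and its embedding by cosine and sine *)

Lemma periodic_int (R : realType) (f : R -> R) T (m : int) :
  periodic f T -> forall a, f (a + T *~ m) = f a.
Proof.
move=> fT a; case: m => m; first exact: periodicn.
by rewrite NegzE mulrNz -[LHS](periodicn fT m.+1) -pmulrn subrK.
Qed.

Section Torus.
Variables (R : realType) (n : nat).

Lemma torus_projP (x y : 'rV[R]_n) :
  torus_proj x = torus_proj y <-> forall j, x 0 j - y 0 j \is a Num.int.
Proof.
rewrite /torus_proj; split.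
  by move=> /eqmodP /forallP.
by move=> xy; apply/eqmodP/forallP.
Qed.

Lemma torus_proj_translate (x : 'rV[R]_n) (m : 'rV[int]_n) :
  torus_proj (x + map_mx intr m) = torus_proj x.
Proof. by apply/torus_projP => j; rewrite !mxE addrAC subrr add0r intr_int. Qed.

Lemma torus_proj_continuous : continuous (@torus_proj R n).
Proof. exact: pi_continuous. Qed.

(** If the fractional part [r] of [x] is nonzero, then [sin (r * pi) > 0], and the double angle
    formula puts [cos (r * (pi *+ 2))] strictly below 1. *)
Lemma cos2pi_eq1 (x : R) : cos (x * (pi *+ 2)) = 1 -> x \is a Num.int.
Proof.
move=> cx; set r := x - (Num.floor x)%:~R.
have r0 : 0 <= r by rewrite subr_ge0 floor_le_tmp.
have r1 : r < 1 by rewrite ltrBlDl -intrD1 floorD1_gt.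
have [r00|rn0] := eqVneq r 0.
  by rewrite -(subrK (Num.floor x)%:~R x) -/r r00 add0r intr_int.
have : cos (r * (pi *+ 2)) = 1.
  by rewrite mulrBl mulrzl -mulrNz periodic_int//; exact: cosD2pi.
have rpi : 0 < r * pi < pi.
  rewrite mulr_gt0 ?pi_gt0//= ?gtr_pMl ?pi_gt0//.
  by rewrite lt_neqAle eq_sym rn0.
have := sin_gt0_pi rpi.
rewrite (_ : r * (pi *+ 2) = (r * pi) *+ 2) ?mulrnAr// cos_mulr2n cos2sin2.
move: (sin _) => s s0 s1; exfalso; nra.
Qed.

Lemma cos_sin_2pi_int (x y : R) : cos (x * (pi *+ 2)) = cos (y * (pi *+ 2)) ->
  sin (x * (pi *+ 2)) = sin (y * (pi *+ 2)) -> x - y \is a Num.int.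
Proof.
move=> cxy sxy; apply: cos2pi_eq1.
by rewrite mulrBl cosB cxy sxy -!expr2 cos2Dsin2.
Qed.

(* Embeds the torus in a Hausdorff space, so that images of compact sets in the
torus are closed. *)
Definition cos_sin_mx (x : 'rV[R]_n) : 'rV[R]_n * 'rV[R]_n :=
  (map_mx (fun t => cos (t * (pi *+ 2))) x, map_mx (fun t => sin (t * (pi *+ 2))) x).

Lemma cos_sin_mxP (x y : 'rV[R]_n) :
  cos_sin_mx x = cos_sin_mx y <-> torus_proj x = torus_proj y.
Proof.
rewrite torus_projP; split=> [[] /rowP cxy /rowP sxy j|xy].
  by apply: cos_sin_2pi_int; [have := cxy j|have := sxy j]; rewrite !mxE.
have xyE j : x 0 j * (pi *+ 2) = y 0 j * (pi *+ 2) + (pi *+ 2) *~ Num.floor (x 0 j - y 0 j).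
  by rewrite -mulrzl -mulrDl floorK// addrC subrK.
congr (_, _); apply/rowP => j; rewrite !mxE xyE periodic_int//.
  exact: cosD2pi.
exact: sinD2pi.
Qed.

Lemma map_mx_continuous (f : R -> R) :
  continuous f -> continuous (map_mx f : 'rV[R]_n -> 'rV[R]_n).
Proof.
move=> cf x A [P xP PA]; exists (fun i j => f @^-1` P i j).
  by move=> i j; apply: cf; have := xP i j; rewrite mxE.
by move=> y yP; apply: PA => i j; rewrite mxE; exact: yP.
Qed.

Lemma cos_sin_mx_continuous : continuous cos_sin_mx.
Proof.
have mul_cont : continuous (fun t : R => t * (pi *+ 2)).
  exact: mulrr_continuous.
have cosc : continuous (fun t : R => cos (t * (pi *+ 2))).
  by move=> t; exact: (continuous_comp (@mul_cont t) (@continuous_cos _ _)).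
have sinc : continuous (fun t : R => sin (t * (pi *+ 2))).
  by move=> t; exact: (continuous_comp (@mul_cont t) (@continuous_sin _ _)).
move=> x; exact: (cvg_pair (map_mx_continuous cosc (x := x))
                           (map_mx_continuous sinc (x := x))).
Qed.

(** In the quotient topology this asks that the saturation of [K] be closed. It is the preimage
    under the continuous [cos_sin_mx] of the image of [K], which is compact in a Hausdorff space. *)
Lemma torus_proj_image_closed (K : set 'rV[R]_n) :
  compact K -> closed (@torus_proj R n @` K).
Proof.
move=> Kc; rewrite -[X in closed X]setCK; apply: open_closedC.
rewrite /open/= /quotient_open; rewrite preimage_setC; apply: closed_openC.
rewrite [X in closed X](_ : _ = cos_sin_mx @^-1` (cos_sin_mx @` K)); last first.
  apply/seteqP; split=> x [y Ky yx]; exists y => //; exact/cos_sin_mxP.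
apply: preimage_closed; first by move=> x _; exact: cos_sin_mx_continuous.
apply: compact_closed; first exact: norm_hausdorff.
apply: continuous_compact => //; apply: continuous_subspaceT.
exact: cos_sin_mx_continuous.
Qed.

End Torus.

(** * Linear simplices over the torus *)

Section Simplices.
Variables (R : realType) (n : nat).

Lemma simplex_coord_inj k : injective (@simplex_coord R k).
Proof. exact: val_inj. Qed.

Lemma simplex_coord_continuous k : continuous (@simplex_coord R k).
Proof. exact: initial_continuous. Qed.

Lemma continuous_sum (T : topologicalType) (V : normedModType R) (J : Type)
    (s : seq J) (f : J -> T -> V) :
  (forall j, continuous (f j)) -> continuous (fun t => \sum_(j <- s) f j t).
Proof.
move=> fc; elim: s => [|j s IH] t.
  by under eq_fun do rewrite big_nil; exact: cvg_cst.
under eq_fun do rewrite big_cons.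
by apply: cvgD; [exact: fc|exact: IH].
Qed.

Lemma std_simplex_compact k : compact (@std_simplex R k).
Proof.
have -> : @std_simplex R k =
    [set t | forall i, `[0, 1]%classic (t 0 i)] `&`
    (fun t => \sum_i t 0 i) @^-1` [set x : R | x = 1].
  apply/seteqP; split=> t /=.
    case=> t0 t1; split=> // i; rewrite /= in_itv /= t0 -t1.
    by rewrite (bigD1 i)//= lerDl sumr_ge0.
  by case=> t01 t1; split=> // i; have := t01 i; rewrite /= in_itv /= => /andP[].
apply: compact_closedI.
  apply: (@rV_compact R _ (fun=> `[0, 1 : R]%classic)) => _.
  exact: segment_compact.
apply: preimage_closed; last exact: closed_eq.
move=> x _; apply: continuous_sum => i; exact: coord_continuous.
Qed.

Lemma affine_continuous k (y : 'I_k.+1 -> 'rV[R]_n) :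
  continuous (fun t : 'rV[R]_k.+1 => \sum_i t 0 i *: y i).
Proof.
apply: continuous_sum => i t.
exact: (continuous_comp (@coord_continuous R 1 k.+1 0 i t)
                        (@scalel_continuous R _ (y i) _)).
Qed.

Lemma affine_simplex_continuous k (y : 'I_k.+1 -> 'rV[R]_n) :
  continuous (affine_simplex y).
Proof.
move=> t; rewrite /affine_simplex.
apply: (@continuous_comp _ _ _ _ (@torus_proj R n)); last first.
  exact: torus_proj_continuous.
apply: (@continuous_comp _ _ _ (@simplex_coord R k)
  (fun t => \sum_i t 0 i *: y i)); first exact: simplex_coord_continuous.
exact: affine_continuous.
Qed.

Lemma simplex_sum1 k (t : simplex R k) : \sum_i simplex_coord t 0 i = 1.
Proof. by have [] : std_simplex (simplex_coord t) := set_valP t. Qed.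

(** Barycentric coordinates sum to 1, so every point moves by [m]. This renormalizes a face that
    omits the first vertex, so that its own first vertex is untranslated. *)
Lemma affine_simplex_translate k (y : 'I_k.+1 -> 'rV[R]_n) (m : 'rV[int]_n) :
  affine_simplex (fun i => map_mx intr m + y i) = affine_simplex y.
Proof.
apply/funext => t; rewrite /affine_simplex.
under eq_bigr do rewrite scalerDr.
by rewrite big_split /= -scaler_suml simplex_sum1 scale1r addrC torus_proj_translate.
Qed.

Lemma affine_simplex_face m k (phi : 'I_m.+1 -> 'I_k.+1) (y : 'I_k.+1 -> 'rV[R]_n) :
  affine_simplex y \o @face_map R m k phi = affine_simplex (y \o phi).
Proof.
apply/funext => t; rewrite /affine_simplex /=; congr torus_proj.
rewrite [RHS](partition_big phi predT) //=; apply: eq_bigr => j _.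
rewrite mxE scaler_suml; apply: eq_bigr => i /eqP <- //.
Qed.

(** The complement of an open [U] in the closed simplex is compact, so its image is closed. By
    injectivity on the whole closed simplex, the complement of that image cuts out exactly the image
    of [U]. *)
Lemma affine_simplex_embedding k (y : 'I_k.+1 -> 'rV[R]_n) :
  injective (affine_simplex y) ->
  embedding_on (@simplex_interior R k) (affine_simplex y).
Proof.
move=> yinj; split.
- exact/continuous_subspaceT/affine_simplex_continuous.
- by move=> s t _ _ /yinj.
move=> U [B Bo BU]; exists (~` (affine_simplex y @` ~` U)).
  apply: closed_openC.
  (* [U] is the trace of an open set [B] of the ambient space, so the points outside [U] form a
     compact set there. *)
  have -> : affine_simplex y @` (~` U) = @torus_proj R n @`
     ((fun t : 'rV[R]_k.+1 => \sum_i t 0 i *: y i) @` (@std_simplex R k `&` ~` B)).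
    apply/seteqP; split=> [_ [t Ut <-]|_ [_ [t [tk tB] <-] <-]].
      exists (\sum_i simplex_coord t 0 i *: y i) => //.
      exists (simplex_coord t) => //; split; first exact: set_valP.
      by move=> tB; apply: Ut; rewrite -BU.
    exists (SigSub (mem_set tk)); last by rewrite /affine_simplex.
    by rewrite -BU.
  apply: torus_proj_image_closed; apply: continuous_compact.
    exact/continuous_subspaceT/affine_continuous.
  apply: compact_closedI; [exact: std_simplex_compact|exact: open_closedC].
apply/seteqP; split=> [_ [t [tA tU] <-]|_ [[t tA <-] tU]].
  by split; [exists t|move=> [s sU /yinj st]; apply: sU; rewrite st].
exists t => //; split=> //; apply: contrapT => nU; apply: tU.
by exists t.
Qed.
End Simplices.

(** * Composition of exponents and faces of simplices *)

Section Exponents.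
Variables (R : realType) (n : nat) (F : based_sequence R n).
Local Notation I := (bs_index F).
Local Notation deg := (@bs_deg _ _ F).

Lemma exponents1_deg (i j : I) m : exponents1 i j m -> deg i = deg j + 1.
Proof. by case=> hi _; exact/eqP. Qed.

(** Merges the two clauses of [exponents] into paths of any positive length. Paths are total
    functions on [nat], so that they can be joined without casts between ordinals. *)
Lemma exponentsP (i j : I) m : exponents i j m <->
  exists k (p : nat -> I) (ms : nat -> 'rV[int]_n), [/\ (0 < k)%N, p 0 = j, p k = i,
    forall l, (l < k)%N -> exponents1 (p l.+1) (p l) (ms l)
    & m = \sum_(l < k) ms l].
Proof.
split.
  case=> [ijm|[[|k] [k1 _ [p [ms [p0 pk _ pms ->]]]]]] //.
    exists 1, (fun l => if l is 0 then j else i), (fun=> m); split=> //.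
      by case.
    by rewrite big_ord1.
  exists k.+1, (fun l => p (inord l)), (fun l => ms (inord l)); split=> //.
  - by rewrite -p0; congr p; apply/val_inj; rewrite /= inordK.
  - by rewrite -pk; congr p; apply/val_inj; rewrite /= inordK.
  - move=> l lk; have := pms (inord l); congr (exponents1 (p _) (p _) _).
      by apply/val_inj; rewrite /= !inordK// ltnS.
    by apply/val_inj; rewrite /= !inordK// ltnS ltnW.
  - by apply: eq_bigr => l _; rewrite inord_val.
move=> [k [p [ms [k0 p0 pk pms ->]]]].
have degp l : (l <= k)%N -> deg (p l) = deg j + l%:Z.
  elim: l => [|l IH] lk; first by rewrite p0 addr0.
  by rewrite (exponents1_deg (pms _ lk)) IH 1?ltnW// -addrA -addn1 PoszD.
have [k1|k1] := eqVneq k 1.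
  by left; subst k; rewrite big_ord1 -pk -p0; exact: pms.
right; exists k; split; first by rewrite ltn_neqAle eq_sym k1.
  by rewrite -pk degp.
exists (fun l : 'I_k.+1 => p l), (fun l : 'I_k => ms l); split=> // l.
  by rewrite degp// -ltnS.
by rewrite lift0; exact: pms.
Qed.

(** The two paths are joined at [i], the one starting from [h] coming first. *)
Lemma exponents_trans (j i h : I) m m' :
  exponents j i m -> exponents i h m' -> exponents j h (m' + m).
Proof.
move=> /exponentsP [k [p [ms [k0 p0 pk pms ->]]]].
move=> /exponentsP [k' [p' [ms' [k'0 p'0 p'k pms' ->]]]].
apply/exponentsP; exists (k' + k)%N.
exists (fun l => if (l <= k')%N then p' l else p (l - k')%N).
exists (fun l => if (l < k')%N then ms' l else ms (l - k')%N).
split=> //.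
- by rewrite addn_gt0 k'0.
- by rewrite leqNgt -{1}[k']addn0 ltn_add2l k0 addKn.
- move=> l lk; case: ltnP => lk'; first by rewrite ltnW//; exact: pms'.
  rewrite subSn//.
  (* At the junction [l = k'] both paths pass through [i]. *)
  have -> : (if (l <= k')%N then p' l else p (l - k')%N) = p (l - k')%N.
    by case: ifP => // lk''; rewrite (@anti_leq l k') ?lk''// subnn p0.
  by apply: pms; rewrite ltn_subLR.
- rewrite big_split_ord /=; congr (_ + _); apply: eq_bigr => l _.
    by rewrite ltn_ord.
  by rewrite ltnNge leq_addr addKn.
Qed.

Lemma exponents_ltdeg (i j : I) m : exponents i j m -> deg j < deg i.
Proof.
case=> [/exponents1_deg ->|[k [k1 -> _]]]; first by rewrite ltrDl.
by rewrite ltrDl ltz_nat ltnW.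
Qed.

Lemma exponents_steps k (i : 'I_k.+1 -> I) (m : 'I_k -> 'rV[int]_n) :
  (forall l : 'I_k,
    exponents (i (lift ord0 l)) (i (widen_ord (leqnSn k) l)) (m l)) ->
  forall a b : 'I_k.+1, (a < b)%N ->
    exponents (i b) (i a) (\sum_(l < k | (a <= l < b)%N) m l).
Proof.
move=> im a [b bk] /=; elim: b => // b IH in bk *.
rewrite ltnS => ab; have bk' : (b < k)%N by [].
have step := im (Ordinal bk').
rewrite (_ : lift _ _ = Ordinal bk) in step; last exact/val_inj.
rewrite (_ : widen_ord _ _ = Ordinal (ltnW bk)) in step; last exact/val_inj.
have -> : \sum_(l < k | (a <= l < b.+1)%N) m l =
    \sum_(l < k | (a <= l < b)%N) m l + m (Ordinal bk').
  rewrite (bigD1 (Ordinal bk')) /=; last by rewrite ab ltnSn.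
  rewrite addrC; congr (_ + _); apply: eq_bigl => l.
  by rewrite -val_eqE /=; lia.
(* If [a = b], nothing precedes the new step, and it is the whole path. *)
have [ab'|ba] := ltnP a b.
  by apply: exponents_trans step _; exact: (IH (ltnW bk)).
rewrite big1 => [|l]; last by lia.
rewrite add0r; move: step; congr (exponents _ (i _) _).
by apply/val_inj => /=; apply/eqP; rewrite eqn_leq ab ba.
Qed.

(** [e' l] collects the steps between two consecutive vertices of the face, so its partial sums
    telescope. What remains is the offset of the first vertex of the face, an integer translation
    common to all its vertices. *)
Lemma exponents_face k m (phi : 'I_m.+1 -> 'I_k.+1) (i : 'I_k.+1 -> I)
    (e : 'I_k -> 'rV[int]_n) :
  {homo phi : a b / (a < b)%N} ->
  (forall l : 'I_k,
    exponents (i (lift ord0 l)) (i (widen_ord (leqnSn k) l)) (e l)) ->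
  exists e' : 'I_m -> 'rV[int]_n,
    (forall l : 'I_m, exponents (i (phi (lift ord0 l)))
      (i (phi (widen_ord (leqnSn m) l))) (e' l)) /\
    forall l : 'I_m.+1, \sum_(l' < k | (l' < phi l)%N) e l' =
      \sum_(l' < k | (l' < phi ord0)%N) e l' + \sum_(l' < m | (l' < l)%N) e' l'.
Proof.
move=> phi_mono ie.
pose e' (l : 'I_m) := \sum_(t < k | (phi (widen_ord (leqnSn m) l) <= t <
  phi (lift ord0 l))%N) e t.
exists e'; split=> [l|[l lm]].
  by apply: exponents_steps => //; apply: phi_mono; rewrite lift0 /=.
elim: l => [|l IH] in lm *.
  rewrite [X in _ + X]big1// addr0; apply: eq_bigl => l'.
  by rewrite (_ : Ordinal lm = ord0)//; exact/val_inj.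
have lm' : (l < m)%N by [].
have phil : (phi (Ordinal (ltnW lm)) < phi (Ordinal lm))%N by exact: phi_mono.
have -> : \sum_(l' < m | (l' < Ordinal lm)%N) e' l' =
    \sum_(l' < m | (l' < Ordinal (ltnW lm))%N) e' l' + e' (Ordinal lm').
  rewrite (bigD1 (Ordinal lm')) /=; last exact: ltnSn.
  rewrite addrC; congr (_ + _); apply: eq_bigl => l'.
  by rewrite -val_eqE /=; lia.
rewrite addrA -(IH (ltnW lm)) /e'.
rewrite (_ : widen_ord _ _ = Ordinal (ltnW lm)); last exact/val_inj.
rewrite (_ : lift _ _ = Ordinal lm); last exact/val_inj.
rewrite (bigID (fun l' : 'I_k => (l' < phi (Ordinal (ltnW lm)))%N)) /=.
congr (_ + _); apply: eq_bigl => l'; lia.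
Qed.

Lemma complex_of_linear (x : I -> 'rV[R]_n) : linear_family (complex_of x).
Proof. by move=> k _ [i [m [_ ->]]]; eexists. Qed.

End Exponents.

(** * Locally Lipschitz functions of finitely many real variables *)

Section LocallyLipschitz.
Variables (R : realType) (A : finType).
Implicit Types (f g : (A -> R) -> R) (u v : A -> R).

(** Lipschitz for the sup distance on each cube [-B, B]^A. The bound [d] stands for that distance,
    which avoids a norm on [A -> R]; its sign is stated since [A] may be empty. *)
Definition locally_lipschitz f := forall B : R, 0 <= B -> exists2 L, 0 <= L &
  forall u v d, (forall a, `|u a| <= B) -> (forall a, `|v a| <= B) ->
    0 <= d -> (forall a, `|u a - v a| <= d) -> `|f u - f v| <= L * d.

Lemma locally_lipschitz_cst r : locally_lipschitz (fun=> r).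
Proof. by move=> B B0; exists 0 => // u v d _ _ d0 _; rewrite subrr normr0 mul0r. Qed.

Lemma locally_lipschitz_coord a : locally_lipschitz (fun u => u a).
Proof. by move=> B B0; exists 1 => // u v d _ _ d0 uv; rewrite mul1r. Qed.

Lemma locally_lipschitzD f g : locally_lipschitz f -> locally_lipschitz g ->
  locally_lipschitz (fun u => f u + g u).
Proof.
move=> ff gg B B0; have [L L0 fL] := ff B B0; have [K K0 gK] := gg B B0.
exists (L + K) => [|u v d uB vB d0 uv]; first exact: addr_ge0.
rewrite mulrDl opprD addrACA; apply: le_trans (ler_normD _ _) _.
by rewrite lerD ?fL ?gK.
Qed.

Lemma locally_lipschitzM f g : locally_lipschitz f -> locally_lipschitz g ->
  locally_lipschitz (fun u => f u * g u).
Proof.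
move=> ff gg B B0; have [L L0 fL] := ff B B0; have [K K0 gK] := gg B B0.
(* Comparison with the value at the origin bounds [h] on the cube. *)
have bnd h H : (forall u v d, (forall a, `|u a| <= B) -> (forall a, `|v a| <= B) ->
    0 <= d -> (forall a, `|u a - v a| <= d) -> `|h u - h v| <= H * d) ->
    forall u, (forall a, `|u a| <= B) -> `|h u| <= `|h (fun=> 0)| + H * B.
  move=> hH u uB; rewrite -[h u](subrK (h (fun=> 0))) addrC.
  apply: le_trans (ler_normD _ _) _; rewrite lerD2l hH// => a.
    by rewrite normr0.
  by rewrite subr0.
exists ((`|f (fun=> 0)| + L * B) * K + (`|g (fun=> 0)| + K * B) * L).
  by rewrite addr_ge0// mulr_ge0// addr_ge0// mulr_ge0.
move=> u v d uB vB d0 uv.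
have -> : f u * g u - f v * g v = f u * (g u - g v) + g v * (f u - f v) by ring.
apply: le_trans (ler_normD _ _) _; rewrite !normrM mulrDl.
apply: lerD; rewrite -mulrA; apply: ler_pM => //.
- exact: bnd fL _ uB.
- exact: gK.
- exact: bnd gK _ vB.
- exact: fL.
Qed.

Lemma locally_lipschitz_sum (J : Type) (s : seq J) (f : J -> (A -> R) -> R) :
  (forall j, locally_lipschitz (f j)) ->
  locally_lipschitz (fun u => \sum_(j <- s) f j u).
Proof.
move=> ff; elim: s => [|j s IH].
  rewrite (_ : (fun u => _) = fun=> 0); first exact: locally_lipschitz_cst.
  by apply/funext => u; rewrite big_nil.
rewrite (_ : (fun u => _) = fun u => f j u + \sum_(j <- s) f j u).
  exact: locally_lipschitzD.
by apply/funext => u; rewrite big_cons.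
Qed.

End LocallyLipschitz.

(** * Null sets: countable unions and Lipschitz images of smaller dimension *)

Section MeasureZero.
Variables (R : realType) (n : nat) (I : finType).
(** Without coordinates every box would have the empty product 1 as volume, and no sequence of boxes
    would have small total volume. *)
Hypotheses (I_gt0 : (0 < #|I|)%N) (n_gt0 : (0 < n)%N).
Implicit Types (A : set (I -> 'rV[R]_n)) (a b x : I -> 'rV[R]_n).

Definition box a b : set (I -> 'rV[R]_n) :=
  [set x | forall i j, a i 0 j <= x i 0 j <= b i 0 j].

Definition box_volume a b : R := \prod_i \prod_j (b i 0 j - a i 0 j).

Lemma box_volume_ge0 a b : (forall i j, a i 0 j <= b i 0 j) -> 0 <= box_volume a b.
Proof.
by move=> ab; apply: prodr_ge0 => i _; apply: prodr_ge0 => j _; rewrite subr_ge0.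
Qed.

Lemma box_volume_side a b h : (forall i j, b i 0 j - a i 0 j = h) ->
  box_volume a b = h ^+ (#|I| * n).
Proof.
move=> ab; rewrite /box_volume.
under eq_bigr do under eq_bigr do rewrite ab.
by under eq_bigr do rewrite prodr_const card_ord; rewrite prodr_const -exprM mulnC.
Qed.

(** Transfers coverings indexed by any countable type, finite ones included, to sequences of
    boxes. *)
Lemma measure_zero_countable_cover A :
  (forall e : R, 0 < e -> exists (T : countType) (a b : T -> I -> 'rV[R]_n),
    [/\ forall t i j, a t i 0 j <= b t i 0 j,
        A `<=` \bigcup_t box (a t) (b t)
      & (\esum_(t in [set: T]) (box_volume (a t) (b t))%:E <= e%:E)%E]) ->
  measure_zero A.
Proof.
move=> cov e e0; have [T [a [b [ab Aab vol]]]] := cov e e0.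
pose ext (c : T -> I -> 'rV[R]_n) (k : nat) := oapp c (fun=> 0) (pickle_inv k).
have abk k i j : ext a k i 0 j <= ext b k i 0 j.
  by rewrite /ext; case: pickle_inv => //=.
exists (ext a), (ext b); split=> //.
  move=> x /Aab[t _ xt]; exists (pickle t) => //.
  by rewrite /ext pickleK_inv.
apply: le_trans vol.
rewrite nneseries_esumT; last by move=> k; rewrite lee_fin box_volume_ge0.
set vol := fun k => (box_volume (ext a k) (ext b k))%:E.
have volT t : vol (pickle t) = (box_volume (a t) (b t))%:E.
  by rewrite /vol /ext pickleK_inv.
under [leRHS]eq_esum do rewrite -volT.
rewrite -(esum_image [set: T] (@pickle T) vol); last first.
  by move=> s t _ _; exact: (pcan_inj pickleK_inv).
rewrite esum_mkcond [leRHS]esum_mkcond.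
apply: le_esum => k _; rewrite in_setT; case: ifPn => // /negP kT.
rewrite /vol /ext; case kE: (pickle_inv k) => [t|] /=.
  by case: kT; apply/mem_set; exists t => //; have := @pickle_invK T k; rewrite kE.
(* An index that encodes no element of [T] carries the box reduced to the origin, of volume 0. *)
rewrite (@box_volume_side _ _ 0); first by rewrite expr0n gtn_eqF// muln_gt0 I_gt0.
by move=> i j; rewrite !mxE subrr.
Qed.

Lemma measure_zeroS A B : A `<=` B -> measure_zero B -> measure_zero A.
Proof.
move=> AB B0 e /B0[a [b [ab Bab vol]]]; exists a, b; split=> //.
exact: subset_trans Bab.
Qed.

Lemma measure_zero0 : measure_zero (set0 : set (I -> 'rV[R]_n)).
Proof.
apply: measure_zero_countable_cover => e e0.
exists void, (of_void _), (of_void _); split=> //.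
by rewrite esum1 ?lee_fin ?ltW// => -[].
Qed.

Lemma measure_zero_bigcup_nat (A : nat -> set (I -> 'rV[R]_n)) :
  (forall k, measure_zero (A k)) -> measure_zero (\bigcup_k A k).
Proof.
move=> A0; apply: measure_zero_countable_cover => e e0.
have ek k : 0 < e / (2 ^ k.+1)%:R by rewrite divr_gt0// ltr0n expn_gt0.
have /choice[ab abP] k : exists ab : (nat -> I -> 'rV[R]_n) * (nat -> I -> 'rV[R]_n),
   [/\ forall l i j, ab.1 l i 0 j <= ab.2 l i 0 j,
    A k `<=` \bigcup_l box (ab.1 l) (ab.2 l) &
    (\sum_(0 <= l <oo) (box_volume (ab.1 l) (ab.2 l))%:E <= (e / (2 ^ k.+1)%:R)%:E)%E].
  by have [a [b abP]] := A0 k _ (ek k); exists (a, b).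
exists (nat * nat)%type, (fun t => (ab t.1).1 t.2), (fun t => (ab t.1).2 t.2).
split=> [t i j||].
- by have [] := abP t.1.
- by move=> x [k _ Akx]; have [_ /(_ x Akx)[l _ xl] _] := abP k; exists (k, l).
have vol0 k l : (0 <= (box_volume ((ab k).1 l) ((ab k).2 l))%:E)%E.
  by rewrite lee_fin box_volume_ge0//; have [] := abP k.
apply: le_trans (epsilon_trick0 xpredT (ltW e0)).
rewrite nneseries_esumT; last by move=> k; rewrite lee_fin ltW.
rewrite -setXTT -(@esum_esum _ _ _ setT (fun=> setT)
  (fun k l => (box_volume ((ab k).1 l) ((ab k).2 l))%:E))//.
apply: le_esum => k _.
by rewrite -nneseries_esumT//; have [] := abP k.
Qed.

Lemma measure_zero_bigcup (J : countType) (A : J -> set (I -> 'rV[R]_n)) :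
  (forall j, measure_zero (A j)) -> measure_zero (\bigcup_j A j).
Proof.
move=> A0; pose A' k := oapp A set0 (pickle_inv k).
apply: (@measure_zeroS _ (\bigcup_k A' k)).
  by move=> x [j _ Ajx]; exists (pickle j) => //; rewrite /A' pickleK_inv.
apply: measure_zero_bigcup_nat => k; rewrite /A'.
by case: pickle_inv => [j|] /=; [exact: A0|exact: measure_zero0].
Qed.

Lemma unit_interval_cell (M : nat) (v : R) : 0 <= v <= 1 ->
  exists i : 'I_M.+1, `|v - i%:R / M.+1%:R| <= M.+1%:R^-1.
Proof.
move=> /andP[v0 v1]; have M0 : 0 < M.+1%:R :> R by rewrite ltr0n.
have [q /andP[qv vq]] : exists q : nat, q%:R <= v * M.+1%:R < q.+1%:R.
  by exists (Num.truncn (v * M.+1%:R)); apply: truncn_itv; rewrite mulr_ge0// ltW.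
(* The minimum matters only at [v = 1], where the truncation is [M.+1]. *)
have qM : (minn q M < M.+1)%N by rewrite ltnS geq_minr.
exists (Ordinal qM) => /=.
have -> : v - (minn q M)%:R / M.+1%:R = (v * M.+1%:R - (minn q M)%:R) / M.+1%:R.
  by rewrite mulrBl mulfK// gt_eqF.
rewrite normrM normfV (gtr0_norm M0) ler_piMl ?invr_ge0//.
have vM : v * M.+1%:R <= M.+1%:R by rewrite ler_piMl// ltW.
move: vq vM; rewrite -![_.+1%:R]natr1 => vq vM.
rewrite ler_norml; case: (leqP q M) => [qM'|Mq].
  by lra.
have : M.+1%:R <= q%:R :> R by rewrite ler_nat.
by rewrite -natr1; lra.
Qed.

(* The cube [-B, B]^P is cut into M.+1 ^ #|P| subcubes of side 2 B / M.+1. *)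
Lemma lipschitz_image_cover (P : finType) (g : (P -> R) -> I -> 'rV[R]_n) (B L : R) M :
  0 <= B -> 0 <= L ->
  (forall i j u v d, (forall p, `|u p| <= B) -> (forall p, `|v p| <= B) ->
    0 <= d -> (forall p, `|u p - v p| <= d) -> `|g u i 0 j - g v i 0 j| <= L * d) ->
  exists a b : {ffun P -> 'I_M.+1} -> I -> 'rV[R]_n,
    [/\ forall t i j, b t i 0 j - a t i 0 j = 4 * L * B / M.+1%:R,
     forall t i j, a t i 0 j <= b t i 0 j
    & g @` [set u | forall p, `|u p| <= B] `<=` \bigcup_t box (a t) (b t)].
Proof.
move=> B0 L0 gL; have M0 : 0 < M.+1%:R :> R by rewrite ltr0n.
(* [c t] is the lower corner of the subcube [t], and [r] bounds how far [g] moves from its value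
   there; the boxes have half-side [r]. *)
pose c (t : {ffun P -> 'I_M.+1}) p := - B + 2 * B * ((t p)%:R / M.+1%:R).
pose r := L * (2 * B / M.+1%:R).
have r0 : 0 <= r by rewrite /r !mulr_ge0// invr_ge0 ltW.
exists (fun t i => \row_j (g (c t) i 0 j - r)), (fun t i => \row_j (g (c t) i 0 j + r)).
split=> [t i j|t i j|_ [u uB <-]].
- by rewrite !mxE /r; field; rewrite gt_eqF.
- by rewrite !mxE; lra.
have /choice[t tP] p : exists q : 'I_M.+1, `|u p - (- B + 2 * B * (q%:R / M.+1%:R))| <=
   2 * B / M.+1%:R.
  (* For [B = 0] the cube is a point, and it cannot be rescaled to the unit cube. *)
  have [BE|Bn0] := eqVneq B 0.
    exists ord0; have := uB p; rewrite BE !(mulr0, mul0r, oppr0, addr0, subr0)//.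
  have Bgt0 : 0 < B by rewrite lt_neqAle eq_sym Bn0.
  have [|q qP] := @unit_interval_cell M ((u p + B) / (2 * B)).
    have := uB p; rewrite ler_norml => /andP[uB1 uB2].
    rewrite divr_ge0 ?mulr_ge0//=; last by lra.
    by rewrite ler_pdivrMr ?mulr_gt0//; lra.
  exists q.
  have -> : u p - (- B + 2 * B * (q%:R / M.+1%:R)) =
     2 * B * ((u p + B) / (2 * B) - q%:R / M.+1%:R).
    by field; rewrite Bn0 gt_eqF.
  by rewrite normrM ger0_norm ?mulr_ge0// ler_wpM2l ?mulr_ge0.
exists [ffun p => t p] => //= i j; rewrite !mxE.
have : `|g u i 0 j - g (c [ffun p => t p]) i 0 j| <= r.
  apply: gL => // [p||p]; rewrite /c ?ffunE//; last by rewrite !mulr_ge0// invr_ge0 ltW.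
  have tM : (t p)%:R / M.+1%:R <= 1 :> R.
    by rewrite ler_pdivrMr// mul1r ler_nat ltnW.
  have t0 : 0 <= (t p)%:R / M.+1%:R :> R by rewrite divr_ge0// ltW.
  by move: tM t0; move: (_ / _) => q q1 q0; rewrite ler_norml; apply/andP; split; nra.
by rewrite ler_norml; lra.
Qed.

(** On a fixed cube, the image is covered by [M.+1 ^ #|P|] boxes of side [C / M.+1] with [C]
    independent of [M]. For [N = #|I| * n] their total volume is [C ^+ N / M.+1 ^ (N - #|P|)], at
    most [C ^+ N / M.+1] because [#|P| < N]. *)
Lemma range_measure_zero (P : finType) (g : (P -> R) -> I -> 'rV[R]_n) :
  (#|P| < #|I| * n)%N -> (forall i j, locally_lipschitz (fun u => g u i 0 j)) ->
  measure_zero (range g).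
Proof.
move=> dimP glip.
apply: (@measure_zeroS _ (\bigcup_(B : nat) (g @` [set u | forall p, `|u p| <= B.+1%:R]))).
  move=> _ [u _ <-].
  pose B := Num.truncn (\sum_p `|u p|); exists B => //; exists u => // p.
  apply: (@le_trans _ _ (\sum_p `|u p|)); last first.
    exact/ltW/truncnS_gt.
  by rewrite (bigD1 p)//= lerDl sumr_ge0.
apply: measure_zero_bigcup => B0; set B : R := B0.+1%:R.
have B_ge0 : 0 <= B by [].
have [L L0 gL] : exists2 L, 0 <= L & forall i j u v d, (forall p, `|u p| <= B) ->
   (forall p, `|v p| <= B) -> 0 <= d -> (forall p, `|u p - v p| <= d) ->
   `|g u i 0 j - g v i 0 j| <= L * d.
  have /choice[L LP] ij : exists L, 0 <= L /\ forall u v d, (forall p, `|u p| <= B) ->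
     (forall p, `|v p| <= B) -> 0 <= d -> (forall p, `|u p - v p| <= d) ->
     `|g u ij.1 0 ij.2 - g v ij.1 0 ij.2| <= L * d.
    by have [L ? ?] := glip ij.1 ij.2 B B_ge0; exists L.
  (* The sum of the Lipschitz constants serves all coordinates of [g] at once. *)
  exists (\sum_ij L ij); first by apply: sumr_ge0 => ij _; have [] := LP ij.
  move=> i j u v d uB vB d0 uv; have [_ /(_ u v d uB vB d0 uv) gL] := LP (i, j).
  apply: le_trans gL _; apply: ler_wpM2r => //.
  by rewrite (bigD1 (i, j))//= lerDl sumr_ge0// => ij _; have [] := LP ij.
apply: measure_zero_countable_cover => e e0.
pose C := 4 * L * B; pose N := (#|I| * n)%N.
have C0 : 0 <= C by rewrite /C !mulr_ge0.
(* Chosen so that [C ^+ N / M.+1] is at most [e]. *)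
pose M := Num.truncn (C ^+ N / e).
have M0 : 0 < M.+1%:R :> R by rewrite ltr0n.
have M1 : 1 <= M.+1%:R :> R by rewrite ler1n.
have [a [b [abE ab gab]]] := lipschitz_image_cover M B_ge0 L0 gL.
exists {ffun P -> 'I_M.+1}, a, b; split=> //.
have finT : finite_set [set: {ffun P -> 'I_M.+1}] by exact: finite_finset.
rewrite esum_fset//; last by move=> t _; rewrite lee_fin box_volume_ge0.
rewrite fsumEFin// lee_fin -set_true.
rewrite -(@bigfs _ _ _ _ (index_enum _)) ?index_enum_uniq//; last first.
  by move=> t _; rewrite mem_index_enum.
under eq_bigr do rewrite (box_volume_side (abE _)).
rewrite sumr_const card_ffun card_ord -/C -/N -[_ *+ _]mulr_natr natrX.
have CM : C ^+ N <= e * M.+1%:R.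
  by rewrite -ler_pdivrMl// mulrC ltW// /M truncnS_gt.
have -> : (C / M.+1%:R) ^+ N * M.+1%:R ^+ #|P| = C ^+ N / M.+1%:R ^+ (N - #|P|).
  rewrite exprMn exprVn -mulrA; congr (_ * _).
  have dimN : (#|P| <= N)%N by exact: ltnW.
  by rewrite -{1}(subnK dimN) exprD invfM mulfVK// expf_neq0// gt_eqF.
rewrite ler_pdivrMr ?exprn_gt0//; apply: le_trans CM _.
rewrite ler_pM2l//; have := dimP; rewrite -subn_gt0; case: (N - _)%N => // q _.
by rewrite exprS ler_peMr ?(ltW M0)// exprn_ege1.
Qed.

End MeasureZero.

(** * Configurations of points satisfying an integral relation *)

Section DegenerateConfigurations.
Variables (R : realType) (n : nat) (I : finType).

(** In the application [s] is the difference of the barycentric coordinates of two points with the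
    same image in the torus, and [w] holds the integer offsets of the vertices. *)
Definition integral_relation k (i : 'I_k.+1 -> I) (w : 'I_k.+1 -> 'rV[R]_n)
    (N : 'rV[R]_n) (p : 'I_k.+1) : set (I -> 'rV[R]_n) :=
  [set x | exists s : 'I_k.+1 -> R,
     [/\ \sum_l s l = 0, s p != 0 & \sum_l s l *: (x (i l) + w l) = N]].

Lemma integral_relation_measure_zero k (i : 'I_k.+1 -> I) w N p :
  injective i -> (k < n)%N -> measure_zero (integral_relation i w N p).
Proof.
move=> i_inj kn.
have I_gt0 : (0 < #|I|)%N by apply/card_gt0P; exists (i p).
have n_gt0 : (0 < n)%N by exact: leq_ltn_trans kn.
(* A single vertex forces [s p = 0], so the set is empty. From here on the simplex has [k.+2]
   vertices, and [k.+1 < n]. *)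
case: k => [|k] in i w p i_inj kn *.
  apply: measure_zeroS (measure_zero0 I_gt0 n_gt0) => x [s [s0 sp _]].
  by move: s0 sp; rewrite big_ord1 (ord1 p) => ->; rewrite eqxx.
pose P := ({i' | i' != i p} * 'I_n + 'I_k.+1)%type.
(* In the equation for [x (i p)] the multiplier of [N] takes the slot of the
   parameter that the sum condition on [s] makes redundant. *)
pose co (u : P -> R) i' c : R :=
  oapp (fun i'' : {i' | i' != i p} => u (inl (i'', c))) 0 (insub i').
pose y u l c := co u (i l) c + w l 0 c.
pose g (u : P -> R) i' := \row_c
  (if i' == i p then
     u (inr ord0) * N 0 c +
     ((1 - \sum_(j < k) u (inr (lift ord0 j))) * y u (lift p ord0) c +
     \sum_(j < k) u (inr (lift ord0 j)) * y u (lift p (lift ord0 j)) c) +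
     - w p 0 c
   else co u i' c).
apply: (@measure_zeroS _ _ _ _ (range g)); last first.
  apply: (range_measure_zero I_gt0 n_gt0) => [|i' c].
    rewrite card_sum card_prod !card_ord card_sig cardC1.
    by move: I_gt0; case: #|I| => // q _; rewrite mulSn addnC ltn_add2r.
  have co_lip i'' : locally_lipschitz (fun u => co u i'' c).
    rewrite /co; case: insub => [i0|] /=; first exact: locally_lipschitz_coord.
    exact: locally_lipschitz_cst.
  have y_lip l : locally_lipschitz (fun u => y u l c).
    by apply: locally_lipschitzD => //; exact: locally_lipschitz_cst.
  rewrite (_ : (fun u => _) = fun u => if i' == i p then
     u (inr ord0) * N 0 c +
     ((1 + -1 * \sum_(j < k) u (inr (lift ord0 j))) * y u (lift p ord0) c +
     \sum_(j < k) u (inr (lift ord0 j)) * y u (lift p (lift ord0 j)) c) +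
     - w p 0 c
   else co u i' c); last by apply/funext => u; rewrite mxE mulN1r.
  case: (i' == i p) => //.
  have cst := @locally_lipschitz_cst R P; have crd := @locally_lipschitz_coord R P.
  apply: locally_lipschitzD => //; apply: locally_lipschitzD.
    exact: locally_lipschitzM.
  apply: locally_lipschitzD.
    apply: locally_lipschitzM => //; apply: locally_lipschitzD => //.
    by apply: locally_lipschitzM => //; apply: locally_lipschitz_sum.
  by apply: locally_lipschitz_sum => j; apply: locally_lipschitzM.
move=> x [s [s0 sp sN]].
(* Division of the relation by [s p] expresses [x (i p)] through [(s p)^-1] and the ratios
   [- s l / s p] for [l != p]. These ratios sum to 1, so the one at [lift p ord0] is recovered from
   the others. *)
pose u (e : P) : R := match e with
  | inl (i', c) => x (val i') 0 c
  | inr j => if j == ord0 then (s p)^-1 else - s (lift p j) / s p end.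
exists u => //; apply/funext => i'; apply/rowP => c; rewrite mxE.
have coE i0 : i0 != i p -> co u i0 c = x i0 0 c.
  by move=> i0p; rewrite /co insubT.
case: eqP => [->|/eqP/coE//].
(* Injectivity of [i] keeps the other vertices away from the index [i p], where [co] takes its
   default value 0. *)
have yE l : y u (lift p l) c = x (i (lift p l)) 0 c + w (lift p l) 0 c.
  by rewrite /y coE// (inj_eq i_inj) eq_sym neq_lift.
rewrite yE; under [X in _ + (_ + X)]eq_bigr do rewrite yE.
have := congr1 (fun v : 'rV[R]_n => v 0 c) sN.
move: s0; rewrite !(bigD1_ord p)//= !big_ord_recl /= => s0.
rewrite !mxE summxE.
under [X in _ + (_ + X) = _ -> _]eq_bigr do rewrite !mxE.
under [X in _ -> _ + (_ + X) - _ = _]eq_bigr do rewrite mulrAC mulNr.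
rewrite -[X in _ -> _ + (_ + X) - _ = _]mulr_suml sumrN -[X in 1 - X]mulr_suml sumrN.
move: s0; move: (\sum_(_ < k) s _) (\sum_(_ < k) _ * _) => S T s0 <-.
have -> : s (lift p ord0) = - s p - S by lra.
by field.
Qed.
End DegenerateConfigurations.

(** * The complex of a based sequence and generic immersion *)

Section Immersed.
Variables (R : realType) (n : nat) (F : based_sequence R n).
Local Notation I := (bs_index F).
Local Notation deg := (@bs_deg _ _ F).

(** Otherwise the indicator of [i] would be the coordinate vector of an element of [F k], hence
    0. *)
Lemma bs_deg_neq (k : int) (i : I) : (forall v : F k, v = 0) -> deg i != k.
Proof.
move=> F0; apply/negP => ik.
have := @bs_vectK _ _ F k [ffun j => (j == exist _ i ik)%:R].
rewrite (F0 (bs_vect _)) linear0 => /ffunP/(_ (exist _ i ik))/esym/eqP.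
rewrite !ffunE eqxx.
by rewrite oner_eq0.
Qed.

Lemma bs_deg_le0 (i : I) : deg i <= 0.
Proof.
rewrite leNgt; apply/negP => i0.
by have := bs_deg_neq i (bs_mod_gt0 i0); rewrite eqxx.
Qed.

Lemma bs_index_gt0 : (0 < #|I|)%N.
Proof.
have [v v0] := bs_mod0 F; rewrite lt0n; apply: contra_neq v0 => I0.
rewrite -[v]bs_coordK -[RHS]bs_coordK linear0; congr bs_vect.
by apply/ffunP => -[i ik]; have := card0_eq I0 i.
Qed.

Lemma complex_of_semi_simplicial (x : I -> 'rV[R]_n) :
  semi_simplicial_complex (complex_of x).
Proof.
split=> [k _ [i [m [_ ->]]]|k _ [i [m [im ->]]] q phi phi_mono].
  exact: affine_simplex_continuous.
rewrite affine_simplex_face; have [m' [im' mm']] := exponents_face phi_mono im.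
exists (i \o phi), m'; split=> //.
(* The face starts at a vertex with a possibly nonzero integer offset, whereas a member of the
   complex starts at an untranslated point. *)
rewrite -[RHS](affine_simplex_translate _ (\sum_(l < k | (l < phi ord0)%N) m l)).
congr affine_simplex; apply/funext => l /=.
by rewrite mm' raddfD addrCA.
Qed.

(** Degrees strictly increase along the vertices, by at least 1 at each step. *)
Lemma complex_of_indices_inj k (i : 'I_k.+1 -> I) (m : 'I_k -> 'rV[int]_n) :
  (forall l : 'I_k,
    exponents (i (lift ord0 l)) (i (widen_ord (leqnSn k) l)) (m l)) ->
  injective i /\ exists a b, deg a + k%:Z <= deg b.
Proof.
move=> im.
have degi (a b : 'I_k.+1) : (a < b)%N -> deg (i a) < deg (i b).
  by move=> ab; exact: exponents_ltdeg (exponents_steps im ab).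
split=> [a b iab|].
  by apply/val_inj; case: (ltngtP a b) => // /degi; rewrite iab ltxx.
suff degl l : (l < k.+1)%N -> deg (i ord0) + l%:Z <= deg (i (inord l)).
  by exists (i ord0), (i (inord k)); exact: degl.
elim: l => [|l IH] lk.
  by rewrite addr0 (_ : inord 0 = ord0)//; apply/val_inj; rewrite /= inordK.
have := degi (inord l) (inord l.+1); rewrite !inordK ?(ltnW lk)// ltnSn => /(_ isT).
by have := IH (ltnW lk); lia.
Qed.

(** Outside the null set constructed here, every simplex is injective even on its boundary, as
    [affine_simplex_embedding] requires. *)
Lemma not_immersed_measure_zero :
  (forall k : nat, (n <= k)%N -> forall v : F (- k%:Z), v = 0) ->
  measure_zero [set x : I -> 'rV[R]_n | ~ immersed (complex_of x)].
Proof.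
move=> F0.
have deg_gt i : - n%:Z < deg i.
  rewrite ltNge; apply/negP => din.
  have nk : (n <= `|deg i|)%N by lia.
  by have := bs_deg_neq i (F0 _ nk); rewrite (_ : - _ = deg i) ?eqxx//; lia.
have I_gt0 := bs_index_gt0.
have n_gt0 : (0 < n)%N.
  have [i _] := card_gt0P I_gt0; have := deg_gt i; have := bs_deg_le0 i; lia.
(* All that a relation depends on. Finite functions make this type countable, so that the union of
   the relations is still null. *)
pose data k := ({ffun 'I_k.+1 -> I} * {ffun 'I_k.+1 -> 'rV[int]_n} *
  'rV[int]_n * 'I_k.+1)%type.
pose A k (t : data k) : set (I -> 'rV[R]_n) := let: (i, w, N, p) := t in
  if injectiveb i && (k < n)%N then
    integral_relation i (fun l => map_mx intr (w l)) (map_mx intr N) p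
  else set0.
apply: (@measure_zeroS _ _ _ _ (\bigcup_k \bigcup_(t : data k) A k t)); last first.
  apply: measure_zero_bigcup => // k; apply: measure_zero_bigcup => // -[[[i w] N] p].
  rewrite /A; case: ifP => [/andP[/injectiveP i_inj kn]|_]; last exact: measure_zero0.
  exact: integral_relation_measure_zero.
move=> x /=; apply: contra_notP => xA k _ [i [m [im ->]]].
have [i_inj [a [b ab]]] := complex_of_indices_inj im.
have kn : (k < n)%N by have := deg_gt a; have := bs_deg_le0 b; lia.
apply: affine_simplex_embedding => t t' /torus_projP tt'.
apply: simplex_coord_inj; apply/rowP => p; apply/eqP.
rewrite -subr_eq0; apply: contrapT => /negP sp; apply: xA.
pose s l := simplex_coord t 0 l - simplex_coord t' 0 l.
pose w (l : 'I_k.+1) := \sum_(l' < k | (l' < l)%N) m l'.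
(* The floor is exact: these sums are differences of the coordinates of two points with the same
   image in the torus. *)
pose N := \row_j Num.floor (\sum_l s l * (x (i l) + map_mx intr (w l)) 0 j).
exists k => //; exists ([ffun l => i l], [ffun l : 'I_k.+1 => w l], N, p) => //.
rewrite /A kn andbT ifT; last first.
  by apply/injectiveP => l l'; rewrite !ffunE => /i_inj.
exists s; split=> //; first by rewrite sumrB !simplex_sum1 subrr.
apply/rowP => j; rewrite !mxE summxE.
have sE : \sum_l s l * (x (i l) + map_mx intr (w l)) 0 j =
   (\sum_l simplex_coord t 0 l *: (x (i l) + map_mx intr (w l))) 0 j -
   (\sum_l simplex_coord t' 0 l *: (x (i l) + map_mx intr (w l))) 0 j.
  rewrite !summxE -sumrB; apply: eq_bigr => l _.
  by rewrite mulrBl; congr (_ - _); rewrite [RHS]mxE.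
rewrite [in RHS]floorK; last by rewrite sE; exact: tt'.
by apply: eq_bigr => l _; rewrite !ffunE [LHS]mxE.
Qed.

End Immersed.

Theorem proposition3p3 (R : realType) (n : nat) (F : based_sequence R n) :
  (forall x : bs_index F -> 'rV[R]_n,
     semi_simplicial_complex (complex_of x) /\ linear_family (complex_of x)) /\
  ((forall k : nat, (n <= k)%N -> forall v : F (- k%:Z), v = 0) ->
   measure_zero [set x : bs_index F -> 'rV[R]_n | ~ immersed (complex_of x)]).
Proof.
split=> [x|]; last exact: not_immersed_measure_zero.
by split; [exact: complex_of_semi_simplicial|exact: complex_of_linear].
Qed.
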